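(* Every tree-like $\mathrm{Res}(\oplus)$ refutation of $\mathrm{DLO}_n$ has size at least $2^{\lfloor (n-3)/3\rfloor}$, and every $\mathrm{Res}(\oplus)$ refutation of $\mathrm{DLO}_n$ has space at least $\lfloor (n-3)/3\rfloor$.
   Context: $\mathrm{DLO}_n$ is the CNF in the variables $(x_{ij})_{i\ne j\in[n]}$ and $(z_{ikj})$ for distinct $i,k,j\in[n]$, consisting of: $\neg x_{ij}\lor\neg x_{ji}$ for $i\neq j$; $x_{ij}\lor x_{ji}$ for $i\ne j$; $\neg x_{ij}\lor\neg x_{jk}\lor x_{ik}$ for distinct $i,j,k$; $\neg z_{ikj}\lor x_{ik}$ and $\neg z_{ikj}\lor x_{kj}$ for distinct $i,j,k$; and $\neg x_{ij}\lor\bigvee_{k\in[n]\setminus\{i,j\}} z_{ikj}$ for $i\ne j$. It is viewed as a linear CNF by writing $x$ as $(x=1)$, $\neg x$ as $(x=0)$. Linear clauses are disjunctions of equations $f=\alpha$, $f$ a linear form over $\mathbb{F}_2$, $\alpha\in\{0,1\}$. $\mathrm{Res}(\oplus)$ rules: from $A\lor(f=0)$ and $B\lor(f=1)$ derive $A\lor B$; from $C$ derive any linear clause semantically implied by $C$. A refutation derives the empty clause from the formula's clauses; it is tree-like if arrangeable as a binary tree (root: empty clause, leaves: formula clauses, internal nodes: results of rule applications to children), size = number of clauses. Space: a refutation is a sequence of configurations (sets of linear clauses) $S_1=\emptyset,\dots,S_t\ni$ empty clause, each obtained from the previous by adding a formula clause, deleting a clause, or adding a clause deduced from current clauses by the rules;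 its space is $\max_i|S_i|$. *)

(* Defs.v *)
From HB Require Import structures.
From mathcomp Require Import all_boot all_algebra.

Set Implicit Arguments.
Unset Strict Implicit.
Unset Printing Implicit Defensive.

Import GRing.Theory.
Local Open Scope ring_scope.

Section Resolution.
Variable V : finType.

(* (v, true) is the literal v, (v, false) is the literal ~ v. *)
Definition literal : finType := (V * bool)%type.
Definition clause : finType := {set literal}.
Definition cnf := clause -> Prop.

(* A linear form is given by its coefficients; a pair (f, a) is the equation
   f = a, and a linear clause is the set of its equations (the disjunction is
   taken up to order and repetition, and set0 is the empty clause). *)
Definition linform : finType := {ffun V -> 'F_2}.
Definition lineq : finType := (linform * 'F_2)%type.
Definition lclause : finType := {set lineq}.
Definition lcnf := lclause -> Prop.

Definition lin_var (v : V) : linform := [ffun w => (w == v)%:R].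
Definition lin_literal (l : literal) : lineq := (lin_var l.1, l.2%:R).
Definition lin_clause (C : clause) : lclause :=
  [set lin_literal l | l in C].
Definition lin_cnf (F : cnf) : lcnf :=
  fun C => exists2 D : clause, F D & C = lin_clause D.

Definition assignment : finType := {ffun V -> 'F_2}.
Definition lin_eval (f : linform) (s : assignment) : 'F_2 :=
  \sum_(v : V) f v * s v.
Definition satisfies (s : assignment) (C : lclause) : bool :=
  [exists e in C, lin_eval e.1 s == e.2].
Definition entails (C D : lclause) : Prop :=
  forall s : assignment, satisfies s C -> satisfies s D.

(* E follows from C and D by the resolution rule on some form f.  The side
   clauses A and B may themselves contain the equation resolved upon. *)
Definition resolvent (C D E : lclause) : Prop :=
  exists (A B : lclause) (f : linform),
    [/\ C = A :|: [set (f, 0)], D = B :|: [set (f, 1)] & E = A :|: B].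

Inductive tree_derivation (F : lcnf) : lclause -> Type :=
| TreeAxiom C of F C : tree_derivation F C
| TreeWeaken C D of tree_derivation F C & entails C D : tree_derivation F D
| TreeResolve C D E of tree_derivation F C & tree_derivation F D
    & resolvent C D E : tree_derivation F E.

Fixpoint tree_size F C (t : tree_derivation F C) : nat :=
  match t with
  | TreeAxiom _ _ => 1
  | TreeWeaken _ _ t1 _ => (tree_size t1).+1
  | TreeResolve _ _ _ t1 t2 _ => (tree_size t1 + tree_size t2).+1
  end.

Definition tree_refutation (F : lcnf) : Type :=
  tree_derivation F (set0 : lclause).

Definition config : finType := {set lclause}.

Definition deducible (S : config) (E : lclause) : Prop :=
  (exists2 C, C \in S & entails C E) \/
  (exists C D, [/\ C \in S, D \in S & resolvent C D E]).

Definition config_step (F : lcnf) (S T : config) : Prop :=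
  [\/ exists2 C, F C & T = C |: S,
      exists2 C, C \in S & T = S :\ C
    | exists2 C, deducible S C & T = C |: S].

(* The last clause forces p to be nonempty, as set0 \notin (set0 : config). *)
Definition refutation (F : lcnf) (p : seq config) : Prop :=
  [/\ head set0 p = set0,
      forall i, (i.+1 < size p)%N ->
        config_step F (nth set0 p i) (nth set0 p i.+1)
    & (set0 : lclause) \in last set0 p].

Definition refutation_space (p : seq config) : nat := \max_(S <- p) #|S|.

End Resolution.

Section DLO.
Variable n : nat.

Definition xindex : finType := {p : 'I_n * 'I_n | p.1 != p.2}.
Definition zindex : finType :=
  {t : 'I_n * 'I_n * 'I_n | uniq [:: t.1.1; t.1.2; t.2]}.
Definition dlo_var : finType := (xindex + zindex)%type.

Definition xvar (i j : 'I_n) (ij : i != j) : dlo_var :=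
  inl (exist (fun p : 'I_n * 'I_n => p.1 != p.2) (i, j) ij).
Definition zvar (i k j : 'I_n) (ikj : uniq [:: i; k; j]) : dlo_var :=
  inr (exist (fun t : 'I_n * 'I_n * 'I_n => uniq [:: t.1.1; t.1.2; t.2])
         (i, k, j) ikj).

Definition pos (v : dlo_var) : literal dlo_var := (v, true).
Definition neg (v : dlo_var) : literal dlo_var := (v, false).

(* The distinctness hypotheses are boolean, so the variables do not
   depend on the proofs supplied.  In dlo_dense, the set comprehension ranges
   over all the z_ikj with the given i and j. *)
Inductive DLO : cnf dlo_var :=
| dlo_antisym i j (ij : i != j) (ji : j != i) :
    DLO [set neg (xvar ij); neg (xvar ji)]
| dlo_total i j (ij : i != j) (ji : j != i) :
    DLO [set pos (xvar ij); pos (xvar ji)]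
| dlo_trans i j k (ij : i != j) (jk : j != k) (ik : i != k) :
    DLO [set neg (xvar ij); neg (xvar jk); pos (xvar ik)]
| dlo_between_l i k j (ikj : uniq [:: i; k; j]) (ik : i != k) :
    DLO [set neg (zvar ikj); pos (xvar ik)]
| dlo_between_r i k j (ikj : uniq [:: i; k; j]) (kj : k != j) :
    DLO [set neg (zvar ikj); pos (xvar kj)]
| dlo_dense i j (ij : i != j) :
    DLO (neg (xvar ij) |:
         [set pos (inr t) | t : zindex & ((val t).1.1 == i) && ((val t).2 == j)]).

End DLO.

(* Main.v *)
(* Call a model an assignment in which x is a strict linear order and z_ikj is
   contained in i < k < j; only the density clauses can fail in a model.  The key
   fact is that a system of r linear equations with 3r + 3 <= n that holds in a
   model s also holds in a model satisfying any prescribed density clause, say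
   that of (i, j) with i < j in s.  For W disjoint from {i, j}, let s_W arise from
   s by moving W to right above i and setting z_ikj = 1 for k in W.  The indicator
   function of the system is an F_2-polynomial of degree r, and each variable
   involves at most 3 elements, so each monomial, as a function of W, ignores one
   of the n - 2 > 3r elements available; hence the indicator sums to 0 over all W.
   As it is 1 at s itself, it is 1 at s_W for some nonempty W.

   Tree-like size: follow both premises of a resolution step when the form has
   both values on the models of the equations collected so far, which happens
   at least floor((n-3)/3) times on each path followed.  Space: each clause in
   memory is implied by a single equation, and these equations hold in a common
   model as long as the space is less than floor((n-3)/3). *)

Require Import Defs.
From mathcomp Require Import all_boot all_algebra.

Set Implicit Arguments.
Unset Strict Implicit.
Unset Printing Implicit Defensive.

Import GRing.Theory.

(** * Arithmetic in the two-element field *)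

Section F2.
Local Open Scope ring_scope.

Lemma F2_addxx (x : 'F_2) : x + x = 0.
Proof. by apply: addrr_pchar2; exact: pchar_Fp. Qed.

Lemma F2_neq (x y : 'F_2) : (x != y) = (x == y + 1).
Proof. by case: x y => [[|[|//]] ?] [[|[|//]] ?]. Qed.

Lemma F2_neq0 (x : 'F_2) : (x != 0) = (x == 1).
Proof. by rewrite F2_neq add0r. Qed.

Lemma F2_cases (x : 'F_2) : x = 0 \/ x = 1.
Proof. by case: (eqVneq x 0) => [|/[!F2_neq0]/eqP]; [left | right]. Qed.

Lemma F2_sum_neq0 (x y : 'F_2) : (x + (y + 1) != 0) = (x == y).
Proof. by case: x y => [[|[|//]] ?] [[|[|//]] ?]. Qed.

End F2.

(** * Sums of low-degree functions over all subsets of a set *)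

Section SubsetSums.
Local Open Scope ring_scope.
Variable T : finType.

Definition depends_only_on (J : {set T}) (h : {set T} -> 'F_2) : Prop :=
  forall k W, k \notin J -> h (k |: W) = h W.

Lemma depends_mul J J' h h' : depends_only_on J h -> depends_only_on J' h' ->
  depends_only_on (J :|: J') (fun W => h W * h' W).
Proof.
by move=> hJ hJ' k W; rewrite inE negb_or => /andP[kJ kJ']; rewrite hJ ?hJ'.
Qed.

(** Toggling a point of [K] outside [J] pairs the subsets of [K]; paired values agree and cancel in
    characteristic 2. *)
Lemma sum_subsets_eq0 (K J : {set T}) h : depends_only_on J h ->
  (#|J| < #|K|)%N -> \sum_(W : {set T} | W \subset K) h W = 0.
Proof.
move=> hJ ltJK.
have /subsetPn[k kK kJ] : ~~ (K \subset J).
  by apply: contraL ltJK => /subset_leq_card; rewrite -leqNgt.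
rewrite (bigID (fun W : {set T} => k \in W)) /=.
rewrite (reindex_onto (fun W => k |: W) (fun W => W :\ k)) /=; last first.
  by move=> W /andP[_ kW]; rewrite setD1K.
rewrite (eq_big (fun W : {set T} => (W \subset K) && (k \notin W)) h); first exact: F2_addxx.
  move=> W; rewrite subUset sub1set kK setU11 /= andbT.
  apply: andb_id2l => _; apply/eqP/idP => [<- | kW]; first by rewrite !inE eqxx.
  by rewrite setU1K.
by move=> W _; exact: hJ.
Qed.

(* Expanding the product gives monomials that are products of [size s] of the
   [phi v], hence depend on too few points to see all of [K]. *)
Lemma sum_subsets_prod_eq0 (V : finType) (d : nat) (phi : V -> {set T} -> 'F_2)
    (supp : V -> {set T}) (K : {set T}) :
  (forall v, depends_only_on (supp v) (phi v)) ->
  (forall v, #|supp v| <= d)%N ->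
  forall (s : seq ((V -> 'F_2) * 'F_2)) J h, depends_only_on J h ->
  (#|J| + d * size s < #|K|)%N ->
  \sum_(W : {set T} | W \subset K)
    h W * \prod_(e <- s) (\sum_v e.1 v * phi v W + e.2) = 0.
Proof.
move=> phi_supp supp_d; elim=> [|e s IHs] J h hJ /= ltK.
  rewrite muln0 addn0 in ltK.
  under eq_bigr do rewrite big_nil mulr1.
  exact: sum_subsets_eq0 hJ ltK.
under eq_bigr => W _.
  rewrite big_cons mulrA [h W * _]mulrDr mulrDl mulr_sumr mulr_suml.
  over.
(* A term with [phi v] moves that factor into [h] and adds [supp v] to [J]; the constant term leaves
   [h] unchanged. *)
rewrite big_split exchange_big /= big1 => [|v _]; last first.
  under eq_bigr => W _ do rewrite mulrCA -mulrA.
  rewrite -mulr_sumr (IHs (J :|: supp v)) ?mulr0 //; first exact: depends_mul.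
  apply: leq_ltn_trans ltK; rewrite mulnS addnA leq_add2r.
  by rewrite (leq_trans (leq_card_setU _ _)) // leq_add2l.
rewrite add0r.
under eq_bigr => W _ do rewrite [h W * _]mulrC -mulrA.
rewrite -mulr_sumr (IHs J) ?mulr0 //.
by apply: leq_ltn_trans ltK; rewrite mulnS leq_add2l leq_addl.
Qed.

End SubsetSums.

(** * Linear equations implying linear clauses *)

Section LinearEquations.
Local Open Scope ring_scope.
Variable V : finType.
Implicit Types (s : assignment V) (e : lineq V) (C : lclause V).

Definition solves s e : bool := lin_eval e.1 s == e.2.

Lemma satisfiesP s C : reflect (exists2 e, e \in C & solves s e) (satisfies s C).
Proof. exact: exists_inP. Qed.

Lemma lin_evalDr (f : linform V) s s' : lin_eval f (s + s') = lin_eval f s + lin_eval f s'.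
Proof.
by rewrite /lin_eval -big_split /=; apply: eq_bigr => v _; rewrite ffunE mulrDr.
Qed.

Lemma lin_evalDl (f g : linform V) s : lin_eval (f + g) s = lin_eval f s + lin_eval g s.
Proof.
by rewrite /lin_eval -big_split /=; apply: eq_bigr => v _; rewrite ffunE mulrDl.
Qed.

Lemma lin_eval_var v s : lin_eval (lin_var v) s = s v.
Proof.
rewrite /lin_eval (bigD1 v) //= ffunE eqxx mul1r big1 ?addr0 // => w wv.
by rewrite ffunE (negbTE wv) mul0r.
Qed.

Lemma sat_lin_clause s (C : clause V) l :
  l \in C -> s l.1 = l.2%:R -> satisfies s (lin_clause C).
Proof.
move=> lC sl; apply/satisfiesP; exists (lin_literal l); first exact: imset_f.
by rewrite /solves lin_eval_var sl.
Qed.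

(** The assignments falsifying a linear clause form an affine subspace, which is closed under sums
    of three. *)
Lemma falsifies_sum3 C s1 s2 s3 :
  ~~ satisfies s1 C -> ~~ satisfies s2 C -> ~~ satisfies s3 C ->
  ~~ satisfies (s1 + s2 + s3) C.
Proof.
move=> n1 n2 n3; apply/satisfiesP => -[e eC].
have neq s : ~~ satisfies s C -> lin_eval e.1 s = e.2 + 1.
  move=> nC; apply/eqP; rewrite -F2_neq; apply: contraNN nC => se.
  by apply/satisfiesP; exists e.
rewrite /solves !lin_evalDr !neq // F2_addxx add0r.
by rewrite eq_sym -F2_neq eqxx.
Qed.

Definition eq_entails e C : Prop := forall s, solves s e -> satisfies s C.

(* If each of e, e' and their sum had a solution falsifying E, the sum of the
   three would falsify E and solve both e and e'. *)
Lemma eq_entails_resolvent e e' C D E : resolvent C D E ->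
  eq_entails e C -> eq_entails e' D ->
  exists2 e'', eq_entails e'' E &
    forall s, solves s e -> solves s e' -> solves s e''.
Proof.
move=> [A [B [f [-> -> ->]]]] eC eD.
have incompatible s : ~~ satisfies s (A :|: B) -> solves s e -> solves s e' -> False.
  move=> nAB /eC/satisfiesP[c + sc] /eD/satisfiesP[d + sd].
  have nsat b : b \in A :|: B -> solves s b -> False.
    by move=> bAB sb; case/satisfiesP: nAB; exists b.
  rewrite !inE => /orP[cA | /eqP cf]; first by case: (nsat c); rewrite ?inE ?cA.
  move=> /orP[dB | /eqP df]; first by case: (nsat d); rewrite ?inE ?dB ?orbT.
  by move: sc sd; rewrite cf df /solves => /eqP ->.
have dec b : eq_entails b (A :|: B) \/ exists2 s, solves s b & ~~ satisfies s (A :|: B).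
  have [|] := boolP [exists s, solves s b && ~~ satisfies s (A :|: B)].
    by move=> /existsP[s /andP[]]; right; exists s.
  rewrite negb_exists => /forallP nb; left=> s sb.
  by move: (nb s); rewrite sb negbK.
case: (dec e) => [?|[s1 s1e n1]]; first by exists e.
case: (dec e') => [?|[s2 s2e n2]]; first by exists e'.
case: (dec (e.1 + e'.1, e.2 + e'.2)) => [?|[s3 s3e n3]].
  exists (e.1 + e'.1, e.2 + e'.2) => // s.
  by rewrite /solves /= lin_evalDl => /eqP -> /eqP ->.
have s1e' : ~~ solves s1 e' by apply/negP; exact: incompatible.
have s2e' : ~~ solves s2 e by apply/negP => /(incompatible _ n2) /(_ s2e).
(* [s1] solves only [e], [s2] only [e'], and [s3] neither, so for each equation the two errors
   cancel in the sum. *)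
exfalso; apply: (incompatible _ (falsifies_sum3 n1 n2 n3)).
  have s3e' : ~~ solves s3 e.
    apply/negP => s3s; apply: (incompatible _ n3 s3s).
    by move: s3e s3s; rewrite /solves /= lin_evalDl => + /eqP s3e_e; rewrite s3e_e => /eqP/addrI ->.
  move: s1e s2e' s3e'; rewrite /solves !F2_neq !lin_evalDr => /eqP-> /eqP-> /eqP->.
  by rewrite -addrA F2_addxx addr0.
have s3e' : ~~ solves s3 e'.
  apply/negP => s3s; apply: (incompatible _ n3 _ s3s).
  by move: s3e s3s; rewrite /solves /= lin_evalDl => + /eqP s3e_e; rewrite s3e_e => /eqP/addIr ->.
move: s2e s1e' s3e'; rewrite /solves !F2_neq !lin_evalDr => /eqP-> /eqP-> /eqP->.
by rewrite addrAC F2_addxx add0r.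
Qed.

End LinearEquations.

(** * Models and their modification by moving a set of elements *)

Section ModelOrders.
Local Open Scope ring_scope.
Variable n : nat.
Implicit Types (lt : rel 'I_n) (bt : 'I_n -> 'I_n -> 'I_n -> bool).

Record pre_dense lt bt : Prop := PreDense {
  lt_irreflexive : irreflexive lt;
  lt_transitive : transitive lt;
  lt_total : forall i j, i != j -> lt i j || lt j i;
  bt_between : forall i k j, bt i k j -> lt i k && lt k j
}.

Definition order_assignment lt bt : assignment (dlo_var n) :=
  [ffun v => match v with
             | inl p => (lt (val p).1 (val p).2)%:R
             | inr t => (bt (val t).1.1 (val t).1.2 (val t).2)%:R
             end].

Definition model (s : assignment (dlo_var n)) : Prop :=
  exists lt bt, pre_dense lt bt /\ s = order_assignment lt bt.

Section Insertion.
Variables (lt : rel 'I_n) (bt : 'I_n -> 'I_n -> 'I_n -> bool) (i j : 'I_n).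
Hypothesis lt_bt : pre_dense lt bt.

(* The elements of W are moved, in their order, to right above i. *)
Definition insert_lt (W : {set 'I_n}) : rel 'I_n := fun a b =>
  match a \in W, b \in W with
  | true, false => lt i b
  | false, true => ~~ lt i a
  | _, _ => lt a b
  end.

(** The move may invalidate old betweenness on triples meeting [W], so these are reset, and only [W]
    between [i] and [j] is recorded. *)
Definition insert_bt (W : {set 'I_n}) (a b c : 'I_n) : bool :=
  if [|| a \in W, b \in W | c \in W] then [&& a == i, b \in W & c == j]
  else bt a b c.

Lemma insert_pre_dense (W : {set 'I_n}) : i \notin W -> j \notin W -> lt i j ->
  pre_dense (insert_lt W) (insert_bt W).
Proof.
case: lt_bt => irr tr tot btw iW jW ij; split.
- by move=> a; rewrite /insert_lt irr; case: (a \in W).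
- move=> b a c; rewrite /insert_lt.
  have ntr x y : lt x y -> ~~ lt i y -> ~~ lt i x.
    by move=> xy; apply: contra => ix; exact: tr ix xy.
  have ntr2 x y : ~~ lt i x -> lt i y -> lt x y.
    move=> ix iy; have [->//|xi] := eqVneq x i.
    by have := tot _ _ xi; rewrite (negbTE ix) orbF => /tr; exact.
  case: (a \in W); case: (b \in W); case: (c \in W) => //.
  + exact: tr.
  + by move=> ib /negP[].
  + by move=> ib bc; exact: tr ib bc.
  + exact: ntr2.
  + exact: ntr.
  + exact: tr.
- move=> a b ab; rewrite /insert_lt.
  by case: (a \in W); case: (b \in W); rewrite ?tot ?orbN // orbC orbN.
- move=> a b c; rewrite /insert_bt /insert_lt.
  case: ifP => [_ /and3P[/eqP-> bW /eqP->]|].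
    by rewrite (negbTE iW) bW (negbTE jW) irr.
  by move=> /negbT; rewrite !negb_or => /and3P[/negbTE-> /negbTE-> /negbTE->] /btw.
Qed.

Definition dlo_support (v : dlo_var n) : {set 'I_n} :=
  match v with
  | inl p => [set (val p).1; (val p).2]
  | inr t => [set (val t).1.1; (val t).1.2; (val t).2]
  end.

Lemma card_dlo_support v : (#|dlo_support v| <= 3)%N.
Proof.
case: v => [p|t] /=; first by rewrite cards2; case: (_ != _).
by rewrite (leq_trans (leq_card_setU _ _)) // cards1 cards2 addn1; case: (_ != _).
Qed.

(** Since [W] moves as a block next to the fixed [i], a variable sees [W] only through the
    membership of its own indices. *)
Lemma insert_depends v : depends_only_on (dlo_support v)
  (fun W => order_assignment (insert_lt W) (insert_bt W) v).
Proof.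
move=> k W kv; rewrite !ffunE.
have in_kW a : a \in dlo_support v -> (a \in k |: W) = (a \in W).
  by move=> av; rewrite !inE; case: eqVneq => // ak; rewrite -ak av in kv.
case: v in_kW {kv} => [p|t] /= in_kW.
  by rewrite /insert_lt !in_kW // !inE eqxx ?orbT.
by rewrite /insert_bt !in_kW // !inE eqxx ?orbT.
Qed.

Lemma insert0 : order_assignment (insert_lt set0) (insert_bt set0)
  = order_assignment lt bt.
Proof.
apply/ffunP=> v; rewrite !ffunE; case: v => [p|t].
  by rewrite /insert_lt !inE.
by rewrite /insert_bt !inE.
Qed.

End Insertion.

(** The product is the indicator of the system, as a polynomial with one linear factor per
    equation. *)
Lemma prod_solves (Es : seq (lineq (dlo_var n))) s :
  all (solves s) Es = (\prod_(e <- Es) (lin_eval e.1 s + (e.2 + 1)) == 1).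
Proof.
rewrite -F2_neq0 prodf_seq_neq0; apply: eq_all => e /=.
by rewrite F2_sum_neq0.
Qed.

Lemma model_extend_dense (Es : seq (lineq (dlo_var n))) s (i j : 'I_n) (ij : i != j) :
  (3 * size Es + 3 <= n)%N -> model s -> all (solves s) Es ->
  exists s', [/\ model s', all (solves s') Es &
    s' (xvar ij) = 0 \/ exists k (ikj : uniq [:: i; k; j]), s' (zvar ikj) = 1].
Proof.
move=> size_Es [lt [bt [pd ->]]] sEs.
have [lij|nlij] := boolP (lt i j); last first.
  exists (order_assignment lt bt); split=> //; first by exists lt, bt.
  by left; rewrite ffunE /= (negbTE nlij).
pose sW W := order_assignment (insert_lt lt i W) (insert_bt bt i j W).
pose K := [set~ i] :\ j.
(* [K] has n - 2 elements, and 3r + 3 <= n gives 3r < n - 2. *)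
have ltK : (#|(set0 : {set 'I_n})| + 3 * size Es < #|K|)%N.
  rewrite cards0 add0n /K cardsDS ?sub1set ?inE 1?eq_sym // cards1 cardsC1 card_ord.
  by rewrite -subn1 -subnDA ltn_subRL addnC -addnS.
have KP (W : {set 'I_n}) : W \subset K -> (i \notin W) /\ (j \notin W).
  by move=> /subsetP WK; split; apply/negP=> /WK; rewrite !inE eqxx ?andbF.
have [/existsP[W /and3P[WK W0 sWE]]|none] := boolP [exists W : {set 'I_n},
    [&& W \subset K, W != set0 & all (solves (sW W)) Es]].
  have [iW jW] := KP _ WK; have [k kW] := set0Pn _ W0.
  exists (sW W); split=> //.
    by exists (insert_lt lt i W), (insert_bt bt i j W); split=> //; exact: insert_pre_dense.
  right; exists k.
  have ikj : uniq [:: i; k; j].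
    rewrite /= !inE negb_or ij !andbT; apply/andP; split.
      by apply: contraNneq iW => ->.
    by apply: contraNneq jW => <-.
  by exists ikj; rewrite ffunE /= /insert_bt kW orbT !eqxx.
have one_only_on0 : depends_only_on (set0 : {set 'I_n}) (fun=> 1) by [].
have := sum_subsets_prod_eq0 (insert_depends lt bt i j) card_dlo_support
  (s := [seq ((e.1 : {ffun _}) : _ -> _, e.2 + 1) | e : lineq (dlo_var n) <- Es])
  one_only_on0.
rewrite size_map => /(_ K ltK).
rewrite (eq_bigr (fun W => \prod_(e <- Es) (lin_eval e.1 (sW W) + (e.2 + 1)))); last first.
  by move=> W _; rewrite mul1r big_map.
have prod1 W : all (solves (sW W)) Es ->
  \prod_(e <- Es) (lin_eval e.1 (sW W) + (e.2 + 1)) = 1.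
  by rewrite prod_solves => /eqP.
(* Without a suitable nonempty [W], the zero sum has the single nonzero term 1 at [set0]. *)
rewrite (bigD1 set0) ?sub0set //= prod1; last by rewrite /sW insert0.
rewrite big1 ?addr0 => [/eqP|W /andP[WK W0]]; first by rewrite oner_eq0.
apply/eqP; apply: contraNT none; rewrite F2_neq0 -prod_solves => sWE.
by apply/existsP; exists W; rewrite WK W0.
Qed.

Lemma model_sat_or_dense s (C : clause (dlo_var n)) : model s -> DLO C ->
  satisfies s (lin_clause C) \/
  exists i j (ij : i != j), C = neg (xvar ij) |:
    [set pos (inr t) | t : zindex n & ((val t).1.1 == i) && ((val t).2 == j)].
Proof.
move=> [lt [bt [[irr tr tot btw] ->]]]; case.
- move=> i j ij ji; left.
  have [lij|nlij] := boolP (lt i j).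
    apply: (@sat_lin_clause _ _ _ (neg (xvar ji))); first by rewrite !inE eqxx ?orbT.
    rewrite ffunE /=; case: (boolP (lt j i)) => // /(tr _ _ _ lij).
    by rewrite irr.
  apply: (@sat_lin_clause _ _ _ (neg (xvar ij))); first by rewrite !inE eqxx ?orbT.
  by rewrite ffunE /= (negbTE nlij).
- move=> i j ij ji; left; have /orP[lij|lji] := tot i j ij.
    apply: (@sat_lin_clause _ _ _ (pos (xvar ij))); first by rewrite !inE eqxx ?orbT.
    by rewrite ffunE /= lij.
  apply: (@sat_lin_clause _ _ _ (pos (xvar ji))); first by rewrite !inE eqxx ?orbT.
  by rewrite ffunE /= lji.
- move=> i j k ij jk ik; left.
  have [lij|nlij] := boolP (lt i j); last first.
    apply: (@sat_lin_clause _ _ _ (neg (xvar ij))); first by rewrite !inE eqxx ?orbT.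
    by rewrite ffunE /= (negbTE nlij).
  have [ljk|nljk] := boolP (lt j k); last first.
    apply: (@sat_lin_clause _ _ _ (neg (xvar jk))); first by rewrite !inE eqxx ?orbT.
    by rewrite ffunE /= (negbTE nljk).
  apply: (@sat_lin_clause _ _ _ (pos (xvar ik))); first by rewrite !inE eqxx ?orbT.
  by rewrite ffunE /= (tr _ _ _ lij ljk).
- move=> i k j ikj ik; left; have [bikj|nb] := boolP (bt i k j); last first.
    apply: (@sat_lin_clause _ _ _ (neg (zvar ikj))); first by rewrite !inE eqxx ?orbT.
    by rewrite ffunE /= (negbTE nb).
  apply: (@sat_lin_clause _ _ _ (pos (xvar ik))); first by rewrite !inE eqxx ?orbT.
  by rewrite ffunE /=; case/andP: (btw _ _ _ bikj) => ->.
- move=> i k j ikj kj; left; have [bikj|nb] := boolP (bt i k j); last first.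
    apply: (@sat_lin_clause _ _ _ (neg (zvar ikj))); first by rewrite !inE eqxx ?orbT.
    by rewrite ffunE /= (negbTE nb).
  apply: (@sat_lin_clause _ _ _ (pos (xvar kj))); first by rewrite !inE eqxx ?orbT.
  by rewrite ffunE /=; case/andP: (btw _ _ _ bikj) => _ ->.
- by move=> i j ij; right; exists i, j, ij.
Qed.

Lemma model_extend (Es : seq (lineq (dlo_var n))) s C :
  (3 * size Es + 3 <= n)%N -> model s -> all (solves s) Es -> lin_cnf (@DLO n) C ->
  exists s', [/\ model s', all (solves s') Es & satisfies s' C].
Proof.
move=> size_Es ms sEs [D DLO_D ->].
have [sC|[i [j [ij ->]]]] := model_sat_or_dense ms DLO_D; first by exists s.
have [s' [ms' s'Es x0_or_z1]] := model_extend_dense ij size_Es ms sEs.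
exists s'; split=> //; case: x0_or_z1 => [x0|[k [ikj z1]]].
  by apply: (@sat_lin_clause _ _ _ (neg (xvar ij))); rewrite ?setU11.
apply: (@sat_lin_clause _ _ _ (pos (zvar ikj))) => //.
apply/setU1r/imsetP.
exists (exist (fun t : 'I_n * 'I_n * 'I_n => uniq [:: t.1.1; t.1.2; t.2]) (i, k, j) ikj) => //.
by rewrite inE /= !eqxx.
Qed.

Lemma model_exists : exists s, model s.
Proof.
exists (order_assignment (fun i j => i < j)%N (fun _ _ _ => false)).
exists (fun i j => i < j)%N, (fun _ _ _ => false); split=> //; split=> //.
- by move=> i; rewrite ltnn.
- by move=> j i k; exact: ltn_trans.
- by move=> i j; rewrite -neq_ltn.
Qed.

End ModelOrders.

(** * Tree-like size and space lower bounds *)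

Section LowerBounds.
Variable n : nat.
Local Notation w := ((n - 3) %/ 3).

Lemma lt_width (k : nat) : k < w -> 3 * k + 3 <= n.
Proof.
move=> kw; have : 3 * k.+1 <= n - 3.
  by rewrite mulnC (leq_trans _ (leq_divM _ 3)) // leq_mul2r.
by rewrite mulnS addnC => /leq_trans; apply; exact: leq_subr.
Qed.

(* [Es] collects the answers to those queries on a root-to-node path for which
   models consistent with the previous answers exist on both sides. *)
Lemma tree_size_ge C (t : tree_derivation (lin_cnf (@DLO n)) C) Es s :
  model s -> all (solves s) Es ->
  (forall s', model s' -> all (solves s') Es -> ~~ satisfies s' C) ->
  2 ^ (w - size Es) <= tree_size t.
Proof.
elim: t Es s => {C} [C FC|C D t IH CD|C D E t1 IH1 t2 IH2 [A [B [f [eqC eqD eqE]]]]]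
    Es s ms sEs nsat /=.
(* Once [w] answers are collected, the truncated exponent is 0; before that, no axiom is falsified
   by all models of [Es]. *)
- have [|lt_w] := leqP w (size Es); first by rewrite -subn_eq0 => /eqP->.
  have [s' [ms' s'Es s'C]] := model_extend (lt_width lt_w) ms sEs FC.
  by have := nsat s' ms' s'Es; rewrite s'C.
- apply/leqW/(IH Es s) => // s' ms' s'Es.
  by apply: contra (nsat s' ms' s'Es); exact: CD.
- have falsC s' : model s' -> all (solves s') Es -> solves s' (f, 1%R) -> ~~ satisfies s' C.
    move=> ms' s'Es s'f; apply: contra (nsat s' ms' s'Es) => /satisfiesP[e + s'e].
    rewrite eqC !inE eqE => /orP[eA | /eqP e_f].
      by apply/satisfiesP; exists e; rewrite ?inE ?eA.
    by move: s'e s'f; rewrite e_f /solves /= => /eqP ->.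
  have falsD s' : model s' -> all (solves s') Es -> solves s' (f, 0%R) -> ~~ satisfies s' D.
    move=> ms' s'Es s'f; apply: contra (nsat s' ms' s'Es) => /satisfiesP[e + s'e].
    rewrite eqD !inE eqE => /orP[eB | /eqP e_f].
      by apply/satisfiesP; exists e; rewrite ?inE ?eB ?orbT.
    by move: s'e s'f; rewrite e_f /solves /= => /eqP ->.
  have [|lt_w] := leqP w (size Es); first by rewrite -subn_eq0 => /eqP->.
  have solves_f s' : solves s' (f, 0%R) \/ solves s' (f, 1%R).
    by rewrite /solves /=; case: (F2_cases (lin_eval f s')) => ->; [left | right].
  (* If [f] is forced to 1, the premise containing [f = 0] is already falsified, and its subtree
     alone gives the bound. *)
  have sat1 : (~ exists s', [/\ model s', all (solves s') Es & solves s' (f, 0%R)]) ->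
      2 ^ (w - size Es) <= tree_size t1.
    move=> no0; apply: (IH1 _ s) => // s' ms' s'Es; apply: falsC => //.
    by case: (solves_f s') => // s'f; case: no0; exists s'.
  have sat2 : (~ exists s', [/\ model s', all (solves s') Es & solves s' (f, 1%R)]) ->
      2 ^ (w - size Es) <= tree_size t2.
    move=> no1; apply: (IH2 _ s) => // s' ms' s'Es; apply: falsD => //.
    by case: (solves_f s') => // s'f; case: no1; exists s'.
  (* The goal is boolean, so this case distinction is available without axioms. *)
  apply: (@classic_EM (exists s', [/\ model s', all (solves s') Es & solves s' (f, 0%R)]) _).
  case=> [[s0 [ms0 s0Es s0f]]|/sat1 le1]; last by rewrite (leq_trans le1) ?leqW ?leq_addr.
  apply: (@classic_EM (exists s', [/\ model s', all (solves s') Es & solves s' (f, 1%R)]) _).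
  case=> [[s1 [ms1 s1Es s1f]]|/sat2 le2]; last by rewrite (leq_trans le2) ?leqW ?leq_addl.
  (* Both answers are possible: each subtree loses one from the exponent, and their sum restores the
     factor 2. *)
  rewrite -subnSK // expnS mul2n -addnn leqW // leq_add //.
    apply: (IH1 ((f, 1%R) :: Es) s1); rewrite /= ?s1f // => s' ms' /andP[s'f s'Es].
    exact: falsC.
  apply: (IH2 ((f, 0%R) :: Es) s0); rewrite /= ?s0f // => s' ms' /andP[s'f s'Es].
  exact: falsD.
Qed.

Lemma card_le_refutation_space (V : finType) (p : seq (config V)) S :
  S \in p -> #|S| <= refutation_space p.
Proof. by move=> Sp; exact: leq_bigmax_seq. Qed.

(** Choosing one equation per clause keeps the system within [#|S|] equations, as [model_extend]
    requires. *)
Definition equation_witnessed (S : config (dlo_var n)) : Prop :=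
  exists (eq_of : lclause (dlo_var n) -> lineq (dlo_var n)) s,
    model s /\ forall C, C \in S -> eq_entails (eq_of C) C /\ solves s (eq_of C).

Lemma equation_witnessed_sub (S T : config (dlo_var n)) : T \subset S ->
  equation_witnessed S -> equation_witnessed T.
Proof.
by move=> /subsetP TS [q [s [ms qs]]]; exists q, s; split=> // C /TS; exact: qs.
Qed.

Lemma equation_witnessed_setU1 (S : config (dlo_var n))
    (q : lclause (dlo_var n) -> lineq (dlo_var n)) s C e :
  model s -> (forall D, D \in S -> eq_entails (q D) D /\ solves s (q D)) ->
  eq_entails e C -> solves s e -> equation_witnessed (C |: S).
Proof.
move=> ms qs eC se; exists (fun D => if D == C then e else q D), s; split=> // D.
by case: eqVneq => [-> //|DC]; rewrite !inE (negbTE DC); exact: qs.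
Qed.

(** An axiom may force a new model, which supplies a true equation of that axiom; deletions and
    deductions keep the model. *)
Lemma equation_witnessed_step (S T : config (dlo_var n)) : #|S| < w ->
  config_step (lin_cnf (@DLO n)) S T -> equation_witnessed S -> equation_witnessed T.
Proof.
move=> lt_w step [q [s [ms qs]]]; case: step => [[C FC ->]|[C _ ->]|[C dC ->]].
- have size_q : 3 * size [seq q D | D in S] + 3 <= n by rewrite size_map -cardE lt_width.
  have sq : all (solves s) [seq q D | D in S].
    by apply/allP => e /imageP[D /qs[_ sD] ->].
  have [s' [ms' s'q /satisfiesP[e eC s'e]]] := model_extend size_q ms sq FC.
  apply: (@equation_witnessed_setU1 _ q s' _ e) => // [D DS|s'' s''e].
    by split; [case: (qs D DS) | apply: (allP s'q); exact: image_f].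
  by apply/satisfiesP; exists e.
- by apply: (@equation_witnessed_sub S); [exact: subsetDl | exists q, s].
- case: dC => [[D /qs[qD sD] DC]|[A [B [/qs[qA sA] /qs[qB sB] ABC]]]].
    by apply: (equation_witnessed_setU1 ms qs _ sD) => s' /qD; exact: DC.
  have [e eC /(_ s sA sB)] := eq_entails_resolvent ABC qA qB.
  apply: (equation_witnessed_setU1 ms qs eC).
Qed.

Lemma refutation_space_ge (p : seq (config (dlo_var n))) :
  refutation (lin_cnf (@DLO n)) p -> w <= refutation_space p.
Proof.
move=> [p0 steps p_last]; rewrite leqNgt; apply/negP => lt_w.
have card_lt (S : config (dlo_var n)) : S \in p -> #|S| < w.
  by move/card_le_refutation_space/leq_ltn_trans; apply.
have witnessed k : k < size p -> equation_witnessed (nth set0 p k).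
  elim: k => [_|k IHk lt_k].
    rewrite nth0 p0; have [s ms] := model_exists n.
    (* The initial configuration is empty, so the trivial equation 0 = 0 serves as a default. *)
    by exists (fun=> (0%R, 0%R)), s; split=> // C; rewrite inE.
  apply: equation_witnessed_step (steps k lt_k) (IHk (ltnW lt_k)).
  exact/card_lt/mem_nth/ltnW.
have p_gt0 : 0 < size p by case: (p) p_last; rewrite ?inE.
have := witnessed (size p).-1; rewrite nth_last prednK // => /(_ (leqnn _)).
by move=> [q [s [_ /(_ _ p_last)[q0 /q0/satisfiesP[e]]]]]; rewrite inE.
Qed.

End LowerBounds.

Theorem theorem3p9 (n : nat) :
  (forall t : tree_refutation (lin_cnf (@DLO n)),
     2 ^ ((n - 3) %/ 3) <= tree_size t) /\
  (forall p : seq (config (dlo_var n)),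
     refutation (lin_cnf (@DLO n)) p -> (n - 3) %/ 3 <= refutation_space p).
Proof.
split=> [t|]; last exact: refutation_space_ge.
have [s ms] := model_exists n.
rewrite -[_ %/ _]subn0; apply: (tree_size_ge t (Es := [::]) ms) => // s' _ _.
by apply/satisfiesP => -[e]; rewrite inE.
Qed.
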